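(* Let $A\in\mathbb{R}^{n\times n}$ be fixed, and let $B_0\in\mathbb{R}^{n\times n}$. Consider any of the three update rules in the context (Broyden family, generalized PSB family, BGM). Then there is a corresponding symmetric positive definite $W$, namely $W=A$ or $W=B_k$ (at step $k$) for the Broyden family, $W=M^{-2}$ for the generalized PSB family, and $W=I$ for BGM, such that the following holds. Given vectors $s_k\in\mathbb{R}^n$, suppose that at each step $k$ the update rule is applied with $s_k$ replaced by $$\tilde s_k=W^{-1}(B_k-A)^\top s_k$$ and $y_k$ replaced by $\tilde y_k=A\tilde s_k$, and that $\tilde s_k\ne0$ for every step $k$ (as long as $B_k\ne A$). Then the process reaches $A$ in at most $n$ steps, i.e. $B_m=A$ for some $m\le n$ (so $B_n=A$, with the convention that $B_k$ is left unchanged once it equals $A$).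
   Context: In the choices $W=A$ or $W=B_k$ these matrices are understood to be symmetric positive definite. Update rules: for a nonzero direction $s_k$ and $y_k=As_k$, $B_{k+1}$ is computed from $B_k$, so that $B_{k+1}s_k=y_k$, by one of the following. Broyden family (fixed real parameter $\theta$; $A$ and all $B_k$ symmetric): $$B_{k+1}=B_k+\frac{y_ky_k^\top}{s_k^\top y_k}-\frac{B_ks_ks_k^\top B_k}{s_k^\top B_ks_k}+\theta\,\omega_k\omega_k^\top,\qquad \omega_k=\sqrt{s_k^\top B_ks_k}\left(\frac{y_k}{s_k^\top y_k}-\frac{B_ks_k}{s_k^\top B_ks_k}\right),$$ where, for the directions actually used, the update is assumed well defined ($s_k^\top y_k\ne0$, $s_k^\top B_ks_k>0$). Generalized PSB family (fixed symmetric nonsingular $M\in\mathbb{R}^{n\times n}$; $A$ and all $B_k$ symmetric): with $r_k=y_k-B_ks_k$, $$B_{k+1}=B_k+\frac{r_ks_k^\top M^{-2}+M^{-2}s_kr_k^\top}{s_k^\top M^{-2}s_k}-\frac{s_k^\top r_k}{(s_k^\top M^{-2}s_k)^2}M^{-2}s_ks_k^\top M^{-2}.$$ BGM (Broyden's ''good'' method; no symmetry of $A$ or $B_k$ required): $$B_{k+1}=B_k+\frac{(y_k-B_ks_k)s_k^\top}{s_k^\top s_k}.$$ In the present statement these formulas are applied with $(\tilde s_k,\tilde y_k)$ in place of $(s_k,y_k)$. *)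

(* Defs.v *)
From HB Require Import structures.
From mathcomp Require Import all_boot all_order all_algebra.
From mathcomp Require Import reals.
Set Implicit Arguments.
Unset Strict Implicit.
Unset Printing Implicit Defensive.
Import Order.TTheory GRing.Theory Num.Theory.
Local Open Scope ring_scope.

Definition dotv (R : realType) (n : nat) (u v : 'cV[R]_n) : R :=
  (u^T *m v) ord0 ord0.

Definition spd (R : realType) (n : nat) (W : 'M[R]_n) : Prop :=
  W \is symmetricmx /\ (forall v : 'cV[R]_n, v != 0 -> 0 < dotv v (W *m v)).

Definition broyden_omega (R : realType) (n : nat)
    (B : 'M[R]_n) (s y : 'cV[R]_n) : 'cV[R]_n :=
  let sBs := dotv s (B *m s) in
  Num.sqrt sBs *: ((dotv s y)^-1 *: y - sBs^-1 *: (B *m s)).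

Definition broyden_update (R : realType) (n : nat) (theta : R)
    (B : 'M[R]_n) (s y : 'cV[R]_n) : 'M[R]_n :=
  let w := broyden_omega B s y in
  B + (dotv s y)^-1 *: (y *m y^T)
    - (dotv s (B *m s))^-1 *: (B *m s *m s^T *m B)
    + theta *: (w *m w^T).

Definition inv_square (R : realType) (n : nat) (M : 'M[R]_n) : 'M[R]_n :=
  invmx (M *m M).

Definition gpsb_update (R : realType) (n : nat) (M : 'M[R]_n)
    (B : 'M[R]_n) (s y : 'cV[R]_n) : 'M[R]_n :=
  let N := inv_square M in
  let r := y - B *m s in
  let sNs := dotv s (N *m s) in
  B + sNs^-1 *: (r *m s^T *m N + N *m s *m r^T)
    - (dotv s r / sNs ^+ 2) *: (N *m s *m s^T *m N).

Definition bgm_update (R : realType) (n : nat)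
    (B : 'M[R]_n) (s y : 'cV[R]_n) : 'M[R]_n :=
  B + (dotv s s)^-1 *: ((y - B *m s) *m s^T).

Inductive update_rule (R : realType) (n : nat) : Type :=
  | Broyden of R
  | GPSB of 'M[R]_n
  | BGM.
Arguments Broyden {R n} _.
Arguments GPSB {R n} _.
Arguments BGM {R n}.

Definition update (R : realType) (n : nat) (rule : update_rule R n)
    (B : 'M[R]_n) (s y : 'cV[R]_n) : 'M[R]_n :=
  match rule with
  | Broyden theta => broyden_update theta B s y
  | GPSB M => gpsb_update M B s y
  | BGM => bgm_update B s y
  end.

Definition rule_assumptions (R : realType) (n : nat) (rule : update_rule R n)
    (A : 'M[R]_n) (B : nat -> 'M[R]_n) : Prop :=
  match rule with
  | Broyden _ =>
      A \is symmetricmx /\ (forall k, B k \is symmetricmx)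
  | GPSB M =>
      [/\ M \is symmetricmx, M \in unitmx,
          A \is symmetricmx & forall k, B k \is symmetricmx]
  | BGM => True
  end.

Definition update_well_defined (R : realType) (n : nat)
    (rule : update_rule R n) (B : 'M[R]_n) (s y : 'cV[R]_n) : Prop :=
  match rule with
  | Broyden _ => dotv s y != 0 /\ 0 < dotv s (B *m s)
  | _ => True
  end.

(* [B] is the current iterate.  Positive definiteness is an assumption on the
   choices [A] and [B] only; for the other two rules it is a consequence. *)
Definition weight_for (R : realType) (n : nat) (rule : update_rule R n)
    (A B W : 'M[R]_n) : Prop :=
  match rule with
  | Broyden _ => (W = A \/ W = B) /\ spd W
  | GPSB M => W = inv_square M
  | BGM => W = 1%:M
  end.

Definition special_direction (R : realType) (n : nat)
    (A B W : 'M[R]_n) (s : 'cV[R]_n) : 'cV[R]_n :=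
  invmx W *m (B - A)^T *m s.

(* Main.v *)
Require Import Defs.
From HB Require Import structures.
From mathcomp Require Import all_boot all_order all_algebra.
From mathcomp Require Import reals.
Set Implicit Arguments.
Unset Strict Implicit.
Unset Printing Implicit Defensive.
Import Order.TTheory GRing.Theory Num.Theory.
Local Open Scope ring_scope.

(** Let [E = B - A] be the error and [w = W st = E^T s], so that [w^T] lies in
    the row space of [E].  No update enlarges this row space: the
    rows added are combinations of [st^T E^T] and [w^T], using the symmetry
    of [E] outside BGM.  The secant equation says that the new error kills [st],
    whereas [w^T st = st^T W st > 0]; hence [w^T] is lost from the row space and
    the rank of the error strictly decreases at every step. *)

Section RankReduction.
Variables (R : realType) (n : nat).
Implicit Types (u v s y w : 'cV[R]_n) (A B M W : 'M[R]_n).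

(** * Inner products and positive definite weights *)

Lemma dotvC u v : dotv u v = dotv v u.
Proof. by rewrite /dotv -[v^T *m u]trmxK trmx_mul trmxK [RHS]mxE. Qed.

Lemma dotvBr u v w : dotv u (v - w) = dotv u v - dotv u w.
Proof. by rewrite /dotv mulmxBr !mxE. Qed.

Lemma dotvZr a u v : dotv u (a *: v) = a * dotv u v.
Proof. by rewrite /dotv -scalemxAr mxE. Qed.

Lemma mul_rank1 m (x : 'M[R]_(m, 1)) u v : x *m u^T *m v = dotv u v *: x.
Proof. by rewrite -mulmxA [u^T *m v]mx11_scalar mul_mx_scalar. Qed.

Lemma dotv_gt0 v : v != 0 -> 0 < dotv v v.
Proof.
have vvE : dotv v v = \sum_i v i 0 ^+ 2.
  by rewrite /dotv mxE; apply: eq_bigr => i _; rewrite mxE expr2.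
rewrite lt0r vvE sumr_ge0 ?andbT => [|i _]; last exact: sqr_ge0.
apply: contra; rewrite psumr_eq0 => [/allP v0|i _]; last exact: sqr_ge0.
apply/eqP/matrixP => i j; rewrite ord1 mxE.
by apply/eqP; rewrite -sqrf_eq0; apply: v0; rewrite mem_index_enum.
Qed.

Lemma symmetricmxP W : reflect (W^T = W) (W \is symmetricmx).
Proof. by apply: (iffP (is_hermitianmxP _ _ _)); rewrite expr0 scale1r map_mx_id. Qed.

Lemma spd1 : @spd R n 1%:M.
Proof.
split; first by apply/symmetricmxP; rewrite trmx1.
by move=> v v0; rewrite mul1mx dotv_gt0.
Qed.

(** With [V = invmx M] symmetric, the weight is [V^T *m V], so its quadratic form at [v] is the
    squared norm of [V *m v], and [V] is injective. *)
Lemma spd_inv_square (M : 'M[R]_n) :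
  M \is symmetricmx -> M \in unitmx -> spd (inv_square M).
Proof.
move=> /symmetricmxP symM unitM.
have NE : inv_square M = invmx M *m invmx M.
  have unitMM : M *m M \in unitmx by rewrite unitmx_mul unitM.
  rewrite -[RHS](mulKmx unitMM) -[M *m M *m _]mulmxA mulKVmx // mulmxV //.
  by rewrite mulmx1.
have symV : (invmx M)^T = invmx M by rewrite trmx_inv symM.
split; first by apply/symmetricmxP; rewrite NE trmx_mul symV.
move=> v v0; have -> : dotv v (inv_square M *m v)
    = dotv (invmx M *m v) (invmx M *m v).
  by rewrite NE /dotv trmx_mul symV !mulmxA.
apply: dotv_gt0; apply: contra v0 => /eqP Vv0.
by rewrite -[v](mulKVmx unitM) Vv0 mulmx0.
Qed.

Lemma spd_unitmx W : spd W -> W \in unitmx.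
Proof.
move=> [/symmetricmxP symW posW]; rewrite -row_free_unit.
apply: inj_row_free => v vW0; apply/eqP/negPn/negP => v0.
have /posW : v^T != 0 by rewrite -trmx0 (inj_eq trmx_inj).
by rewrite /dotv -[W]symW -trmx_mul vW0 trmx0 mulmx0 mxE ltxx.
Qed.

(** * Secant equations *)

Lemma broyden_secant theta (B : 'M[R]_n) s y :
  dotv s y != 0 -> dotv s (B *m s) != 0 ->
  broyden_update theta B s y *m s = y.
Proof.
move=> sy0 sBs0; rewrite /broyden_update /=.
(* Both normalized vectors in [broyden_omega] have inner product 1 with [s], so the [theta] term
   vanishes on [s]. *)
have ws0 : dotv (broyden_omega B s y) s = 0.
  rewrite dotvC /broyden_omega /= dotvZr dotvBr !dotvZr !mulVf //.
  by rewrite subrr mulr0.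
rewrite !(mulmxDl, mulNmx) -!scalemxAl !mul_rank1 ws0 scale0r !scaler0 addr0.
rewrite -[_ *m B *m s]mulmxA mul_rank1 [dotv y s]dotvC.
by rewrite !scalerA !mulVf // !scale1r [B *m s + y]addrC addrK.
Qed.

(** On [s], the symmetrized term gives [r] plus a multiple of [N *m s], and the last term of the
    update removes exactly that multiple. *)
Lemma gpsb_secant (M B : 'M[R]_n) s y :
  dotv s (inv_square M *m s) != 0 -> gpsb_update M B s y *m s = y.
Proof.
rewrite /gpsb_update /=; set N := inv_square M; set a := dotv s (N *m s) => a0.
have: B *m s + (y - B *m s) = y by rewrite addrC subrK.
move: (y - B *m s) => r rE.
rewrite !(mulmxDl, mulNmx) -!scalemxAl !mulmxDl mul_rank1.
rewrite -![_ *m N *m s]mulmxA !mul_rank1 -/a [dotv r s]dotvC.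
rewrite scalerDr !scalerA mulVf // scale1r.
have -> : dotv s r / a ^+ 2 * a = a^-1 * dotv s r.
  by rewrite expr2 invfM mulrA mulfVK // mulrC.
by rewrite addrA addrK.
Qed.

Lemma bgm_secant (B : 'M[R]_n) s y : s != 0 -> bgm_update B s y *m s = y.
Proof.
move=> s0; rewrite /bgm_update mulmxDl -scalemxAl mul_rank1 scalerA.
by rewrite mulVf ?gt_eqF ?dotv_gt0 // scale1r addrC subrK.
Qed.

(** * Row spaces of the errors *)

Lemma mxrank_lt_of_kernel (E F : 'M[R]_n) (s w : 'cV[R]_n) :
  (F <= E)%MS -> F *m s = 0 -> (w^T <= E)%MS -> dotv w s != 0 ->
  (\rank F < \rank E)%N.
Proof.
move=> FE Fs0 wE ws0; apply: rank_ltmx; rewrite ltmxE FE /=.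
(* If the row spaces agreed, [w^T] would be [D *m F], and [F *m s = 0] would give [w^T *m s = 0]. *)
apply: contra ws0 => EF; have /submxP[D wD] := submx_trans wE EF.
by rewrite /dotv wD -mulmxA Fs0 mulmx0 mxE.
Qed.

(** Every added row is a multiple of [y^T], of [s^T *m B = (B *m s)^T], or of the transposed
    [broyden_omega], a combination of these two. *)
Lemma broyden_update_sub theta (A B : 'M[R]_n) s y :
  B \is symmetricmx -> (y^T <= B - A)%MS -> ((B *m s)^T <= B - A)%MS ->
  (broyden_update theta B s y - A <= B - A)%MS.
Proof.
move=> /symmetricmxP symB yE BsE; rewrite /broyden_update /=.
set w := broyden_omega B s y.
have wE : (w^T <= B - A)%MS.
  rewrite /w /broyden_omega /= linearZ scalemx_sub // linearB /= addmx_sub //.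
    by rewrite linearZ scalemx_sub.
  by rewrite eqmx_opp linearZ scalemx_sub.
rewrite addrAC [_ - _ - A]addrAC [_ + _ - A]addrAC.
have {}BsE : (s^T *m B <= B - A)%MS by rewrite -{1}symB -trmx_mul.
(* Abstracting the error keeps [addmx_sub] from splitting [B - A] itself. *)
move: (B - A) yE BsE wE => E yE BsE wE.
rewrite !addmx_sub ?eqmx_opp ?scalemx_sub //.
- by rewrite mulmx_sub.
- by rewrite -mulmxA mulmx_sub.
- by rewrite mulmx_sub.
Qed.

(** The added rows are combinations of [(N *m s)^T], with [N = inv_square M], and [r^T]; since
    [r = - (B - A) *m s], symmetry of the error puts [r^T] in its row space. *)
Lemma gpsb_update_sub (M A B : 'M[R]_n) s :
  inv_square M \is symmetricmx -> (B - A)^T = B - A ->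
  ((inv_square M *m s)^T <= B - A)%MS ->
  (gpsb_update M B s (A *m s) - A <= B - A)%MS.
Proof.
move=> /symmetricmxP symN symE NsE; rewrite /gpsb_update /=.
have NE : (s^T *m inv_square M <= B - A)%MS by rewrite -{1}symN -trmx_mul.
rewrite addrAC [_ + _ - A]addrAC.
have rE : ((A *m s - B *m s)^T <= B - A)%MS.
  by rewrite -opprB linearN /= eqmx_opp -mulmxBl trmx_mul symE submxMl.
move: (A *m s - B *m s) (B - A) NE rE {NsE symE} => r E NE rE.
rewrite !addmx_sub ?eqmx_opp ?scalemx_sub ?addmx_sub //.
- by rewrite -mulmxA mulmx_sub.
- by rewrite mulmx_sub.
- by rewrite -mulmxA mulmx_sub.
Qed.

Lemma bgm_update_sub (A B : 'M[R]_n) s :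
  (s^T <= B - A)%MS -> (bgm_update B s (A *m s) - A <= B - A)%MS.
Proof.
move=> sE; rewrite /bgm_update addrAC addmx_sub ?scalemx_sub //.
by rewrite mulmx_sub.
Qed.

(** * Rank decrease along the iteration *)

Lemma spd_weight rule A (B W : nat -> 'M[R]_n) k :
  rule_assumptions rule A B -> weight_for rule A (B k) (W k) -> spd (W k).
Proof.
case: rule => [theta|M|] /=; first by move=> _ [].
  by case=> symM unitM _ _ ->; apply: spd_inv_square.
by move=> _ ->; apply: spd1.
Qed.

Lemma rank_error_decreases rule A (B W : nat -> 'M[R]_n) k s st :
  rule_assumptions rule A B -> weight_for rule A (B k) (W k) ->
  st = special_direction A (B k) (W k) s -> st != 0 ->
  update_well_defined rule (B k) st (A *m st) ->
  (\rank (update rule (B k) st (A *m st) - A)%R < \rank (B k - A)%R)%N.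
Proof.
move=> hrule hW stE st0 hwd.
have spdW := spd_weight hrule hW.
have [/symmetricmxP symW posW] := spdW.
have WstE : W k *m st = (B k - A)^T *m s.
  by rewrite stE /special_direction -!mulmxA mulKVmx ?spd_unitmx.
have wE : ((W k *m st)^T <= B k - A)%MS.
  by rewrite WstE trmx_mul trmxK submxMl.
have stWst := posW _ st0.
apply: (@mxrank_lt_of_kernel _ _ st (W k *m st)) => //; last first.
- by rewrite dotvC gt_eqF.
(* The new error kills [st] exactly when the updated matrix agrees with [A] on [st], which is the
   secant equation. *)
- rewrite mulmxBl; apply/eqP; rewrite subr_eq0; apply/eqP.
  case: rule hrule hW hwd => [theta|M|] /= hrule hW.
  + by case=> sy0 sBs; rewrite broyden_secant // gt_eqF.
  + by move=> _; rewrite gpsb_secant // -hW gt_eqF.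
  + by move=> _; rewrite bgm_secant.
case: rule hrule hW hwd => [theta|M|] /= hrule hW.
- case: hrule => /symmetricmxP symA symB _.
  have symE : (B k - A)^T = B k - A.
    by rewrite linearB /= symA (symmetricmxP _ (symB k)).
  have EstE : (((B k - A) *m st)^T <= B k - A)%MS.
    by rewrite trmx_mul symE submxMl.
  (* One of the two vectors is [W k *m st]; the other differs from it by [(B k - A) *m st], up to
     sign. *)
  have {EstE} [AstE BstE] : ((A *m st)^T <= B k - A)%MS
      /\ ((B k *m st)^T <= B k - A)%MS.
    case: hW => -[] WE _; rewrite WE in wE; split=> //.
      have -> : B k *m st = (B k - A) *m st + A *m st by rewrite -mulmxDl subrK.
      by rewrite linearD addmx_sub.
    have -> : A *m st = B k *m st - (B k - A) *m st by rewrite -mulmxBl subKr.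
    by rewrite linearB addmx_sub ?eqmx_opp.
  exact: broyden_update_sub.
- case: hrule => symM unitM /symmetricmxP symA symB _.
  apply: gpsb_update_sub; rewrite -?hW //; first exact/symmetricmxP.
  by rewrite linearB /= symA (symmetricmxP _ (symB k)).
- move=> _; apply: bgm_update_sub.
  by move: wE; rewrite hW mul1mx.
Qed.
End RankReduction.

Theorem proposition2p3 (R : realType) (n : nat) (rule : update_rule R n)
    (A B0 : 'M[R]_n) (B W : nat -> 'M[R]_n) (s st yt : nat -> 'cV[R]_n)
    (hB0 : B 0%N = B0)
    (hrule : rule_assumptions rule A B)
    (hW : forall k, B k != A -> weight_for rule A (B k) (W k))
    (hst : forall k, st k = special_direction A (B k) (W k) (s k))
    (hyt : forall k, yt k = A *m st k)
    (hst0 : forall k, B k != A -> st k != 0)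
    (hwd : forall k, B k != A -> update_well_defined rule (B k) (st k) (yt k))
    (hstep : forall k, B k != A -> B k.+1 = update rule (B k) (st k) (yt k))
    (hstop : forall k, B k = A -> B k.+1 = B k) :
  [/\ forall k, B k != A -> spd (W k),
      exists2 m, (m <= n)%N & B m = A
    & B n = A].
Proof.
have spdW k : B k != A -> spd (W k).
  by move=> /hW; apply: spd_weight.
(* Each step lowers the rank by at least one until it is zero, and the iterate is frozen from then
   on; the truncated subtraction covers both phases. *)
have rankB k : (\rank (B k - A)%R <= n - k)%N.
  elim: k => [|k IHk]; first by rewrite subn0 rank_leq_row.
  have [BkA|BkA] := eqVneq (B k) A.
    by rewrite hstop // BkA subrr mxrank0.
  rewrite subnS -ltnS (leq_trans _ (leqSpred _)) // hstep // hyt.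
  apply: leq_trans IHk.
  apply: (rank_error_decreases hrule (hW k BkA) (hst k) (hst0 k BkA)).
  by rewrite -hyt; apply: hwd.
(* At [k = n] the bound is zero, so [n] itself serves as the witness [m]. *)
have BnA : B n = A.
  apply/eqP; rewrite -subr_eq0 -mxrank_eq0 -leqn0.
  by have := rankB n; rewrite subnn.
by split=> //; exists n.
Qed.
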